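(* Let $b$ be a positive integer, and let $p$ be a prime with $p\equiv\pm1\pmod{b}$ and $\langle -1/b\rangle_p\equiv0\pmod{2}$. Then $$ \sum_{k=0}^{p-1}(b^2k+b-1)\frac{\binom{2k}{k}}{4^k}\binom{-1/b}{k}\binom{1/b-1}{k}\equiv0\pmod{p^2}. $$
   Context: For a $p$-adic integer $x\in\mathbb{Z}_p$, $\langle x\rangle_p\in\{0,1,\ldots,p-1\}$ denotes the least nonnegative residue of $x$ modulo $p$ (here $p\nmid b$, so $-1/b\in\mathbb{Z}_p$). For a number $x$ and $k\in\mathbb{N}$, $\binom{x}{k}=x(x-1)\cdots(x-k+1)/k!$ is the generalized binomial coefficient. The congruence is between $p$-adic integers, in the ring $\mathbb{Z}_p$. *)

(* Defs.v *)
From HB Require Import structures.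
From mathcomp Require Import all_boot all_order all_algebra.
From mathcomp Require Import boolp.

Set Implicit Arguments.
Unset Strict Implicit.
Unset Printing Implicit Defensive.

Import GRing.Theory.
Local Open Scope ring_scope.

(** * The ring of p-adic integers

    [padic_int p_pr] is the inverse limit of the rings Z/p^(n+1), n : nat.  An
    element is the coherent sequence of its canonical representatives
    [x n < p ^ n.+1]: applied with a positive modulus, the single equation
    [x n = x n.+1 %% p ^ n.+1] expresses both that [x n] is reduced and that
    [x n.+1] lifts [x n]. *)

Definition padic_coherent (p : nat) (x : nat -> nat) : Prop :=
  forall n, x n = (x n.+1 %% p ^ n.+1)%N.

Record padic_int (p : nat) (p_pr : prime p) := PadicInt {
  padic_seq :> nat -> nat;
  padic_seqP : padic_coherent p padic_seq }.

Section PadicInt.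

Variables (p : nat) (p_pr : prime p).
Local Notation Zp := (padic_int p_pr).

HB.instance Definition _ := gen_eqMixin Zp.
HB.instance Definition _ := gen_choiceMixin Zp.

Lemma padic_int_ext (x y : Zp) : padic_seq x =1 padic_seq y -> x = y.
Proof.
case: x y => [x xP] [y yP] /= /funext exy.
by subst y; congr PadicInt; exact: Prop_irrelevance.
Qed.

Lemma modn_exp_trans m n : (m %% p ^ n.+2 = m %[mod p ^ n.+1])%N.
Proof. by rewrite modn_dvdm // dvdn_exp2l. Qed.

Lemma padic_expn_gt0 n : (0 < p ^ n)%N.
Proof. by rewrite expn_gt0 prime_gt0. Qed.

Lemma padic_seq_lt (x : Zp) n : (x n < p ^ n.+1)%N.
Proof. by rewrite (padic_seqP x n) ltn_mod padic_expn_gt0. Qed.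

Lemma padic_seq_small (x : Zp) n : (x n %% p ^ n.+1)%N = x n.
Proof. by rewrite modn_small ?padic_seq_lt. Qed.

Lemma padic_of_subproof (f : nat -> nat) :
    (forall n, (f n.+1 = f n %[mod p ^ n.+1])%N) ->
  padic_coherent p (fun n => f n %% p ^ n.+1)%N.
Proof. by move=> fP n; rewrite modn_exp_trans fP. Qed.

Definition padic_of (f : nat -> nat)
    (fP : forall n, (f n.+1 = f n %[mod p ^ n.+1])%N) : Zp :=
  PadicInt p_pr (padic_of_subproof fP).

Lemma padic_add_subproof (x y : Zp) n :
  (x n.+1 + y n.+1 = x n + y n %[mod p ^ n.+1])%N.
Proof. by rewrite (padic_seqP x n) (padic_seqP y n) modnDm. Qed.

Lemma padic_mul_subproof (x y : Zp) n :
  (x n.+1 * y n.+1 = x n * y n %[mod p ^ n.+1])%N.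
Proof. by rewrite (padic_seqP x n) (padic_seqP y n) modnMm. Qed.

Lemma padic_opp_subproof (x : Zp) n :
  (p ^ n.+2 - x n.+1 = p ^ n.+1 - x n %[mod p ^ n.+1])%N.
Proof.
have le1 := ltnW (padic_seq_lt x n); have le2 := ltnW (padic_seq_lt x n.+1).
apply/eqP; rewrite -(eqn_modDr (x n.+1)) subnK // -modnDmr -(padic_seqP x n).
by rewrite subnK // modnn expnS modnMl.
Qed.

Lemma padic_nat_subproof (m n : nat) : (m = m %[mod p ^ n.+1])%N.
Proof. by []. Qed.

Definition padic_nat (m : nat) : Zp := padic_of (padic_nat_subproof m).
Definition padic_add (x y : Zp) : Zp := padic_of (padic_add_subproof x y).
Definition padic_mul (x y : Zp) : Zp := padic_of (padic_mul_subproof x y).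
Definition padic_opp (x : Zp) : Zp := padic_of (padic_opp_subproof x).

Lemma padic_addA : associative padic_add.
Proof.
by move=> x y z; apply: padic_int_ext => n /=; rewrite modnDml modnDmr addnA.
Qed.

Lemma padic_addC : commutative padic_add.
Proof. by move=> x y; apply: padic_int_ext => n /=; rewrite addnC. Qed.

Lemma padic_add0 : left_id (padic_nat 0) padic_add.
Proof.
by move=> x; apply: padic_int_ext => n /=; rewrite mod0n padic_seq_small.
Qed.

Lemma padic_addN : left_inverse (padic_nat 0) padic_opp padic_add.
Proof.
move=> x; apply: padic_int_ext => n /=.
by rewrite modnDml subnK ?modnn ?mod0n // ltnW ?padic_seq_lt.
Qed.

HB.instance Definition _ :=
  GRing.isZmodule.Build Zp padic_addA padic_addC padic_add0 padic_addN.

Lemma padic_mulA : associative padic_mul.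
Proof.
by move=> x y z; apply: padic_int_ext => n /=; rewrite modnMml modnMmr mulnA.
Qed.

Lemma padic_mulC : commutative padic_mul.
Proof. by move=> x y; apply: padic_int_ext => n /=; rewrite mulnC. Qed.

Lemma padic_mul1 : left_id (padic_nat 1) padic_mul.
Proof.
by move=> x; apply: padic_int_ext => n /=; rewrite modnMml mul1n padic_seq_small.
Qed.

Lemma padic_mulDl : left_distributive padic_mul padic_add.
Proof.
move=> x y z; apply: padic_int_ext => n /=.
by rewrite modnMml modnDm mulnDl.
Qed.

Lemma padic_1neq0 : padic_nat 1 != 0.
Proof.
apply/eqP => /(congr1 (fun x : Zp => x 0%N)) /=.
by rewrite expn1 mod0n modn_small // prime_gt1.
Qed.

HB.instance Definition _ := GRing.Zmodule_isComNzRing.Build Zp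
  padic_mulA padic_mulC padic_mul1 padic_mulDl padic_1neq0.

Definition padic_unit : {pred Zp} := fun x => `[< exists y : Zp, y * x = 1 >].

Definition padic_inv (x : Zp) : Zp :=
  if pselect (exists y : Zp, y * x = 1) is left yP then projT1 (cid yP) else x.

Lemma padic_mulVx : {in padic_unit, left_inverse 1 padic_inv *%R}.
Proof.
move=> x /asboolP ux; rewrite /padic_inv; case: pselect => // yP.
exact: projT2 (cid yP).
Qed.

Lemma padic_unitPl (x y : Zp) : y * x = 1 -> padic_unit x.
Proof. by move=> yx; apply/asboolP; exists y. Qed.

Lemma padic_inv_out : {in [predC padic_unit], padic_inv =1 id}.
Proof.
move=> x; rewrite inE /= => /asboolP nux; rewrite /padic_inv.
by case: pselect.
Qed.

HB.instance Definition _ := GRing.ComNzRing_hasMulInverse.Build Zp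
  padic_mulVx padic_unitPl padic_inv_out.

Lemma padic_seq_mod (x : Zp) m n :
  (m <= n)%N -> (x n %% p ^ m.+1)%N = x m.
Proof.
elim: n => [|n IHn]; first by rewrite leqn0 => /eqP->; rewrite padic_seq_small.
rewrite leq_eqVlt => /predU1P[->|]; first by rewrite padic_seq_small.
rewrite ltnS => le_mn; rewrite -(IHn le_mn) (padic_seqP x n).
by rewrite modn_dvdm // dvdn_exp2l.
Qed.

Lemma padic_neq0 (x : Zp) : x != 0 -> exists n, x n != 0%N.
Proof.
move=> /eqP nx0; apply: contrapT => x0; apply: nx0; apply: padic_int_ext => n.
by rewrite [RHS]mod0n; apply/eqP/negPn/negP => xn; apply: x0; exists n.
Qed.

Lemma padic_integral : GRing.integral_domain_axiom Zp.
Proof.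
move=> x y xy0; apply: contrapT => /negP; rewrite negb_or => /andP[].
move=> /padic_neq0[m xm] /padic_neq0[n yn].
pose N := (m + n).+1.
have logn_le (z : Zp) k : (k <= N)%N -> z k != 0%N ->
    (0 < z N)%N /\ (logn p (z N) <= k)%N.
  move=> le_kN; rewrite -(padic_seq_mod z le_kN) => zk.
  have zN : (0 < z N)%N by rewrite lt0n; apply: contra_neq zk => ->; rewrite mod0n.
  by split=> //; rewrite leqNgt -pfactor_dvdn //.
have [|xN lex] := logn_le x m _ xm; first by rewrite leqW ?leq_addr.
have [|yN ley] := logn_le y n _ yn; first by rewrite leqW ?leq_addl.
have := congr1 (fun z : Zp => z N) xy0; rewrite /= mod0n => /eqP.
rewrite -/(dvdn _ _) pfactor_dvdn ?muln_gt0 ?xN // lognM //.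
by apply/negP; rewrite -ltnNge ltnS ltnW // ltnS leq_add.
Qed.

HB.instance Definition _ := GRing.ComUnitRing_isIntegral.Build Zp padic_integral.

End PadicInt.

(** The field Q_p of p-adic numbers; [FracField.tofrac x] is the image of [x] in
    it. *)

Notation padic_num p_pr := {fraction (padic_int p_pr)}.

(** The representative of [x] modulo [p] in [{0, ..., p - 1}], characterized by
    [padic_res_lt] and [padic_resP]. *)

Definition padic_res (p : nat) (p_pr : prime p) (x : padic_int p_pr) : nat :=
  x 0%N.

Lemma padic_res_lt (p : nat) (p_pr : prime p) (x : padic_int p_pr) :
  (padic_res x < p)%N.
Proof. by have := padic_seq_lt x 0; rewrite expn1. Qed.

Lemma padic_natE (p : nat) (p_pr : prime p) m :
  m%:R = padic_nat p_pr m.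
Proof.
elim: m => [|m IHm]; first by [].
rewrite -addn1 natrD IHm; apply: padic_int_ext => n /=.
by rewrite modnDm.
Qed.

Lemma padic_resP (p : nat) (p_pr : prime p) (x : padic_int p_pr) :
  exists y : padic_int p_pr, x = (padic_res x)%:R + p%:R * y.
Proof.
have x0 n : (x n = x 0 %[mod p])%N.
  have := padic_seq_mod x (leq0n n); rewrite expn1 => ->.
  by rewrite modn_small // padic_res_lt.
have x0_le n : (x 0 <= x n)%N.
  by rewrite -(padic_seq_mod x (leq0n n)) leq_mod.
have xdiv n : (p * ((x n.+1 - x 0) %/ p) = x n.+1 - x 0)%N.
  by rewrite mulnC divnK // -eqn_mod_dvd // x0.
have fP n : ((x n.+2 - x 0) %/ p = (x n.+1 - x 0) %/ p %[mod p ^ n.+1])%N.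
  apply/eqP; rewrite -(eqn_pmul2l (prime_gt0 p_pr)) !muln_modr -expnS !xdiv.
  rewrite -(eqn_modDr (x 0%N)) !subnK //.
  by rewrite -(padic_seqP x n.+1) padic_seq_small.
exists (padic_of p_pr fP); rewrite !padic_natE; apply: padic_int_ext => n /=.
rewrite modnMml modnMmr xdiv modnDm /padic_res.
by rewrite subnKC // -(padic_seqP x n).
Qed.

(** By the next lemma the ring inverse of [m%:R] in Z_p, which is [m%:R] itself
    by convention on non-units, is the genuine one as soon as [p] does not
    divide [m]. *)

Lemma padic_natr_unit (p : nat) (p_pr : prime p) m :
  ~~ (p %| m)%N -> (m%:R : padic_int p_pr) \is a GRing.unit.
Proof.
move=> pm; have m_gt0 : (0 < m)%N by case: m pm => //; rewrite dvdn0.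
have cop n : coprime m (p ^ n.+1).
  by rewrite coprime_sym coprimeXl // prime_coprime.
have cancel n a c : (a * m = c * m %[mod p ^ n.+1] -> a = c %[mod p ^ n.+1])%N.
  wlog le_ca : a c / (c <= a)%N => [wl eac|].
    by case/orP: (leq_total c a) => le; [|symmetry]; apply: wl.
  move/eqP; rewrite eqn_mod_dvd ?leq_mul2r ?le_ca ?orbT // -mulnBl.
  by rewrite Gauss_dvdl 1?coprime_sym // -eqn_mod_dvd // => /eqP.
pose f n := (egcdn m (p ^ n.+1)).1.
have fE n : (f n * m = 1 %[mod p ^ n.+1])%N.
  rewrite /f; case: egcdnP => //= km kn -> _.
  by rewrite (eqP (cop n)) modnMDl.
have fP n : (f n.+1 = f n %[mod p ^ n.+1])%N.
  have : (f n.+1 * m = f n * m %[mod p ^ n.+1])%N.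
    by rewrite fE -modn_exp_trans fE modn_exp_trans.
  exact: cancel.
apply/asboolP; exists (padic_of p_pr fP); rewrite padic_natE.
by apply: padic_int_ext => n /=; rewrite modnMm fE.
Qed.

(** Congruence modulo [p ^ n] in Z_p, for elements of Q_p: the difference of
    [u] and [v] lies in [p ^ n * Z_p].  In particular, if [v] is a p-adic
    integer, then so is [u]. *)

Definition padic_eqmod (p : nat) (p_pr : prime p) (n : nat)
    (u v : padic_num p_pr) : Prop :=
  exists z : padic_int p_pr, u - v = (p ^ n)%:R * FracField.tofrac z.

(** The generalized binomial coefficient; [F] is meant to have characteristic
    zero. *)

Definition gbinom (F : fieldType) (x : F) (k : nat) : F :=
  (\prod_(i < k) (x - i%:R)) / k`!%:R.

(* Main.v *)
From HB Require Import structures.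
Require Import Defs.
From mathcomp Require Import all_boot all_order all_algebra.
From mathcomp Require Import ring.
Import GRing.Theory.
Local Open Scope ring_scope.

(** Put [x = -1/b] and [N = x * (x + 1) = (1 - b) / b ^ 2].  Since
    [b ^ 2 * k + b - 1 = b ^ 2 * (k - N)] and

      [gbinom x k * gbinom (-1 - x) k
         = \prod_(i < k) (i * (i + 1) - N) / k! ^ 2],

    the sum is [b ^ 2] times the value at [N] of a polynomial [sum_poly] with
    coefficients in Z_p, all the denominators [4 ^ k] and [k!] with [k < p]
    being prime to [p].

    This polynomial vanishes at [n * (n + 1)] for every even [n < p].  There the
    product above, with [N] replaced by [n * (n + 1)], is the coefficient of
    [X ^ k] in [legendre n], the Legendre polynomial shifted to [[0, 1]], and
    ['C(2k, k) / 4 ^ k] is the [k]-th moment of the arcsine law with density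
    [1 / (pi * sqrt (X * (1 - X)))].  The sum thus becomes the mean of
    [X * Q' - n * (n + 1) * Q] with [Q = legendre n]; the Legendre equation
    [(X * (1 - X) * Q')' + n * (n + 1) * Q = 0] and an integration by parts
    turn it into half the mean of [Q'].  As the arcsine law is invariant under
    [X -> 1 - X] while [Q'] is odd under it for even [n], this mean is zero.

    Now let [a] be the residue of [x] modulo [p].  It is even, and so is
    [a' = p - 1 - a] since [p] is odd, hence [sum_poly] has the two roots
    [a * (a + 1)] and [a' * (a' + 1)].  Both are congruent to [N] modulo [p], as
    [N] is invariant under [x -> -1 - x].  If they are distinct, [sum_poly] is
    divisible by the product of the two linear factors, and its value at [N] is
    divisible by [p ^ 2].  If they coincide, then [p = 2 * a + 1], and
    [N - a * (a + 1) = (x - a) * (x + a + 1)] is already divisible by [p ^ 2]. *)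

(** * The arcsine law *)

Lemma mul_central_bin k :
  (k.+1 * 'C(2 * k.+1, k.+1) = 2 * (2 * k).+1 * 'C(2 * k, k))%N.
Proof.
have -> : (2 * k.+1 = (2 * k).+2)%N by rewrite mulnS.
rewrite -mul_bin_diag /= -mulnA (mul_bin_down (2 * k).+1 k).
rewrite mulnA; congr (_ * _)%N; rewrite mul2n -addnn -addSn addnK.
by rewrite mul2n -addnn addSn addnS.
Qed.

Section Legendre.

Variable F : fieldType.
Hypothesis char0 : [pchar F] =i pred0.

Lemma natrS_neq0 (m : nat) : m.+1%:R != 0 :> F.
Proof. by rewrite (pcharf0P F).1. Qed.

(** Use of a hypothesis whose sides are not monomials, with its multiplier [c];
    what remains is a goal for [ring] or [field]. *)
Lemma eq_linear_comb (c l r x y : F) : l = r -> x - y = c * (l - r) -> x = y.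
Proof. by move=> -> /eqP; rewrite subrr mulr0 subr_eq0 => /eqP. Qed.

Definition arcsine_moment (k : nat) : F := 'C(2 * k, k)%:R / 4%:R ^+ k.

Lemma arcsine_momentS k :
  2 * (k%:R + 1) * arcsine_moment k.+1 = (2 * k%:R + 1) * arcsine_moment k.
Proof.
have n4 : 4%:R != 0 :> F := natrS_neq0 3.
have n4k : 4%:R ^+ k != 0 :> F by rewrite expf_neq0.
have e : (k%:R + 1) * 'C(2 * k.+1, k.+1)%:R
    = 2 * (2 * k%:R + 1) * 'C(2 * k, k)%:R :> F.
  by rewrite !natr1 -!natrM natr1 -!natrM mul_central_bin.
rewrite /arcsine_moment exprS.
apply: (@eq_linear_comb (2 / (4 * 4 ^+ k)) _ _ _ _ e); field.
by rewrite n4 n4k.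
Qed.

(** The linear functional sending ['X^k] to the [k]-th moment, that is, the
    integral against the arcsine law. *)
Definition arcsine_mean (p : {poly F}) : F :=
  \sum_(i < size p) p`_i * arcsine_moment i.

Lemma arcsine_mean_widen n (p : {poly F}) : (size p <= n)%N ->
  arcsine_mean p = \sum_(i < n) p`_i * arcsine_moment i.
Proof.
move=> le_pn; rewrite /arcsine_mean.
rewrite (big_ord_widen _ (fun i => p`_i * arcsine_moment i) le_pn).
rewrite big_mkcond; apply: eq_bigr => i _; case: ifP => // /negbT.
by rewrite -leqNgt => /leq_sizeP-> //; rewrite mul0r.
Qed.

Lemma arcsine_mean_is_scalar : scalar arcsine_mean.
Proof.
move=> a p q; pose n := maxn (size p) (size q).
rewrite !(@arcsine_mean_widen n) ?leq_maxl ?leq_maxr //; last first.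
  apply: leq_trans (size_polyD _ _) _; rewrite geq_max leq_maxr andbT.
  exact: leq_trans (size_scale_leq _ _) (leq_maxl _ _).
rewrite mulr_sumr -big_split; apply: eq_bigr => i _ /=.
by rewrite coefD coefZ mulrDl mulrA.
Qed.

HB.instance Definition _ :=
  GRing.isLinear.Build F {poly F} F _ arcsine_mean arcsine_mean_is_scalar.

Lemma arcsine_meanXn k : arcsine_mean 'X^k = arcsine_moment k.
Proof.
rewrite /arcsine_mean size_polyXn (bigD1 ord_max) //= coefXn eqxx mul1r.
rewrite big1 ?addr0 // => i; rewrite -val_eqE /= => ni.
by rewrite coefXn (negPf ni) mul0r.
Qed.

Lemma arcsine_mean1 : arcsine_mean 1 = 1.
Proof. by rewrite -(expr0 'X) arcsine_meanXn /arcsine_moment muln0 divr1. Qed.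

Lemma scalar_eq0_on_Xn (f : {poly F} -> F) : scalar f ->
  (forall k, f 'X^k = 0) -> forall p, f p = 0.
Proof.
move=> fP fX p; have f0 : f 0 = 0.
  by have := fP (-1) 0 0; rewrite scaler0 addr0 mulN1r addNr.
rewrite -[p]coefK poly_def; elim/big_rec: _ => // i q _ IHq.
by rewrite fP fX IHq mulr0 addr0.
Qed.

Lemma by_parts_derivXn k :
  'X * (1 - 'X) * ('X^k)^`() = k%:R *: ('X^k - 'X^(k.+1)) :> {poly F}.
Proof.
rewrite derivXn; case: k => [|k]; first by rewrite mulr0n mulr0 scale0r.
by rewrite scaler_nat mulrnAr !exprS /=; congr (_ *+ _); ring.
Qed.

Lemma by_parts_Xn k :
  (1 - 2 *: 'X) * 'X^k = 'X^k - 2 *: 'X^(k.+1) :> {poly F}.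
Proof. by rewrite mulrBl mul1r -scalerAl -exprS. Qed.

(** Integration by parts, from [w' = - (1 - 2 X) / (2 X (1 - X)) * w] for the
    density [w = 1 / sqrt (X * (1 - X))].  On powers of ['X] it is the recurrence
    of the moments. *)
Lemma arcsine_mean_by_parts (h : {poly F}) :
  2%:R * arcsine_mean ('X * (1 - 'X) * h^`()) =
  - arcsine_mean ((1 - 2%:R *: 'X) * h).
Proof.
apply/eqP; rewrite -addr_eq0; apply/eqP; move: h; apply: scalar_eq0_on_Xn.
  move=> a p q; rewrite derivD derivZ !mulrDr -!scalerAr !linearP /=; ring.
move=> k; rewrite by_parts_derivXn by_parts_Xn.
rewrite linearZ !linearB linearZ /= !arcsine_meanXn.
by apply: (@eq_linear_comb (-1) _ _ _ _ (arcsine_momentS k)); ring.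
Qed.

(** Applied to powers of ['X], the integration by parts is a first order
    recurrence for the moments, which leaves the total mass as only freedom. *)
Lemma arcsine_mean_unique (f : {poly F} -> F) : scalar f -> f 1 = 1 ->
  (forall h, 2%:R * f ('X * (1 - 'X) * h^`()) = - f ((1 - 2%:R *: 'X) * h)) ->
  f =1 arcsine_mean.
Proof.
move=> fP f1 fparts p; apply/eqP; rewrite -subr_eq0; apply/eqP; move: p.
pose g : {scalar {poly F}} := HB.pack f (GRing.isLinear.Build _ _ _ _ f fP).
have fB p q : f (p - q) = f p - f q := linearB g p q.
have fZ a p : f (a *: p) = a * f p := linearZ_LR g a p.
apply: scalar_eq0_on_Xn => [a p q|]; first by rewrite fP linearP /=; ring.
elim=> [|k IHk]; first by rewrite expr0 f1 arcsine_mean1 subrr.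
have := fparts 'X^k; rewrite by_parts_derivXn by_parts_Xn fZ !fB fZ => e.
have e1 := arcsine_momentS k; rewrite -!arcsine_meanXn in e1.
have n2 : 2 * (k%:R + 1) != 0 :> F.
  by rewrite -[1]/(1%:R) -natrD addn1 -natrM mulnS natrS_neq0.
move/eqP: IHk; rewrite subr_eq0 => /eqP IHk; rewrite -IHk in e1.
apply: (mulfI n2).
by apply: (@eq_linear_comb (-1) _ _ _ _ (congr2 +%R e e1)); ring.
Qed.

(** The reflected functional also satisfies the integration by parts: under the
    reflection [X * (1 - X)] is invariant, while the derivation and [1 - 2 X]
    both change sign. *)
Lemma arcsine_mean_refl (p : {poly F}) :
  arcsine_mean (p \Po (1 - 'X)) = arcsine_mean p.
Proof.
move: p; apply: arcsine_mean_unique.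
- by move=> a p q; rewrite !linearP.
- by rewrite comp_polyC arcsine_mean1.
move=> h; have e := arcsine_mean_by_parts (h \Po (1 - 'X)).
have -> : ('X * (1 - 'X) * h^`()) \Po (1 - 'X)
    = - ('X * (1 - 'X) * (h \Po (1 - 'X))^`()).
  rewrite deriv_comp derivB derivX derivC sub0r.
  by rewrite !comp_polyM comp_polyB comp_polyX comp_polyC; ring.
have -> : ((1 - 2 *: 'X) * h) \Po (1 - 'X)
    = - ((1 - 2 *: 'X) * (h \Po (1 - 'X))).
  rewrite comp_polyM comp_polyB comp_polyC comp_polyZ comp_polyX.
  by rewrite !scaler_nat; ring.
by rewrite !raddfN /= mulrN e.
Qed.

(** * Shifted Legendre polynomials *)

Definition legendre_op (p : {poly F}) := ('X * (1 - 'X) * p^`())^`().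

Lemma legendre_op_coef p k :
  (legendre_op p)`_k = k.+1%:R ^+ 2 * p`_k.+1 - (k * k.+1)%:R * p`_k.
Proof.
rewrite /legendre_op.
have -> : 'X * (1 - 'X) * p^`() = 'X * p^`() - 'X * ('X * p^`()) by ring.
rewrite coef_deriv coefB (coefXM p^`()) (coefXM ('X * p^`())) (coefXM p^`()).
case: k => [|k] /=; rewrite !(coef_deriv p).
  by rewrite mul0n mulr0n mul0r !subr0 !mulr1n expr1n mul1r.
by rewrite natrM; ring.
Qed.

Lemma legendre_op_refl p :
  legendre_op (p \Po (1 - 'X)) = legendre_op p \Po (1 - 'X).
Proof.
rewrite /legendre_op deriv_comp derivB derivX derivC sub0r.
set q := p^`() \Po _.
have -> : 'X * (1 - 'X) * (q * -1) = - (('X * (1 - 'X) * p^`()) \Po (1 - 'X)).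
  by rewrite !comp_polyM comp_polyB comp_polyX comp_polyC -/q; ring.
by rewrite derivN deriv_comp derivB derivX derivC sub0r mulrN1 opprK.
Qed.

(** The coefficients of the power series solution, normalized at 0, of the
    Legendre equation [legendre_op p = - N *: p]. *)
Definition legendre_coef (N : F) (k : nat) : F :=
  (\prod_(i < k) ((i * i.+1)%:R - N)) / k`!%:R ^+ 2.

Lemma fact_natr_neq0 k : k`!%:R != 0 :> F.
Proof. by rewrite -(prednK (fact_gt0 k)) natrS_neq0. Qed.

Lemma legendre_coefS N k :
  k.+1%:R ^+ 2 * legendre_coef N k.+1 = ((k * k.+1)%:R - N) * legendre_coef N k.
Proof.
rewrite /legendre_coef big_ord_recr factS natrM /=.
by field; rewrite fact_natr_neq0 addrC natr1 natrS_neq0.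
Qed.

(** Comparing coefficients, the Legendre equation is a first order recurrence,
    so its polynomial solutions form a space of dimension at most one. *)
Lemma legendre_eq_coef N (p : {poly F}) :
  legendre_op p = - N *: p <-> forall k, p`_k = p`_0 * legendre_coef N k.
Proof.
split=> [eqp|pE].
  elim=> [|k IHk]; first by rewrite /legendre_coef big_ord0 expr1n divr1 mulr1.
  apply: (mulfI (expf_neq0 2 (natrS_neq0 k))).
  rewrite mulrCA legendre_coefS mulrCA -IHk.
  have := congr1 (fun q : {poly F} => q`_k) eqp; rewrite legendre_op_coef coefZ.
  by move=> e; apply: (@eq_linear_comb 1 _ _ _ _ e); ring.
apply/polyP=> k; rewrite legendre_op_coef coefZ pE (pE k) mulrCA legendre_coefS.
by ring.
Qed.

Variable n : nat.
Let N : F := (n * n.+1)%:R.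

Lemma legendre_coef_eq0 k : (n < k)%N -> legendre_coef N k = 0.
Proof.
by move=> lt_nk; rewrite /legendre_coef (bigD1 (Ordinal lt_nk)) //= subrr !mul0r.
Qed.

Lemma legendre_coef_neq0 : legendre_coef N n != 0.
Proof.
rewrite mulf_neq0 ?invr_neq0 ?expf_neq0 ?fact_natr_neq0 // prodf_seq_neq0.
apply/allP=> i _; apply/implyP=> _; rewrite -opprB oppr_eq0 -natrB; last first.
  by rewrite leq_mul ?ltnS // ltnW.
by rewrite (pcharf0P F).1 // -lt0n subn_gt0 ltn_mul ?ltnS.
Qed.

Definition legendre : {poly F} := \poly_(k < n.+1) legendre_coef N k.

Lemma coef_legendre k : legendre`_k = legendre_coef N k.
Proof.
by rewrite coef_poly; case: ltnP => // /legendre_coef_eq0.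
Qed.

Lemma size_legendre : size legendre = n.+1.
Proof. by rewrite size_poly_eq // legendre_coef_neq0. Qed.

Lemma legendre_eq : legendre_op legendre = - N *: legendre.
Proof.
apply/legendre_eq_coef => k; rewrite !coef_legendre.
by rewrite {2}/legendre_coef big_ord0 expr1n divr1 mul1r.
Qed.

(** The reflected polynomial solves the same equation, hence is proportional to
    [legendre]; the leading coefficients determine the factor. *)
Lemma legendre_refl : legendre \Po (1 - 'X) = (-1) ^+ n *: legendre.
Proof.
have sz : size (1 - 'X : {poly F}) = 2%N.
  by rewrite -opprB size_polyN size_XsubC.
have [c e] : exists c, legendre \Po (1 - 'X) = c *: legendre.
  have := legendre_op_refl legendre; rewrite legendre_eq comp_polyZ.
  move/legendre_eq_coef => e; exists (legendre \Po (1 - 'X))`_0.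
  by apply/polyP=> k; rewrite e coefZ coef_legendre.
have := lead_coef_comp legendre (q := 1 - 'X); rewrite sz => /(_ isT).
rewrite size_legendre e lead_coefZ -opprB lead_coefN lead_coefXsubC mulrC.
by move/mulfI->; rewrite // lead_coef_eq0 -size_poly_eq0 size_legendre.
Qed.

(** By the Legendre equation the argument on the left is
    [(1 - X) * Q' + X * (1 - X) * Q''] with [Q = legendre].
    Integrating the second term by parts replaces it by
    [- (1 - 2 X) / 2 * Q'], which leaves [Q' / 2]. *)
Lemma arcsine_mean_legendre :
  2 * arcsine_mean ('X * legendre^`() - N *: legendre) =
  arcsine_mean legendre^`().
Proof.
have -> : 'X * legendre^`() - N *: legendre
    = (1 - 'X) * legendre^`() + 'X * (1 - 'X) * legendre^`()^`().
  rewrite -scaleNr -legendre_eq /legendre_op !derivM derivB derivX derivC.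
  by ring.
rewrite raddfD /= mulrDr arcsine_mean_by_parts.
have -> : (1 - 2 *: 'X) * legendre^`()
    = 2 *: ((1 - 'X) * legendre^`()) - legendre^`().
  by rewrite !scaler_nat; ring.
by rewrite raddfB /= linearZ /=; ring.
Qed.

Lemma arcsine_mean_deriv_legendre : ~~ odd n -> arcsine_mean legendre^`() = 0.
Proof.
move=> even_n; have := legendre_refl; rewrite -signr_odd (negPf even_n) scale1r.
move/(congr1 (fun p => p^`())).
rewrite deriv_comp derivB derivX derivC sub0r mulrN1.
move/(congr1 arcsine_mean); rewrite raddfN /= arcsine_mean_refl.
move/eqP; rewrite eq_sym -addr_eq0 -mulr2n -mulr_natl mulf_eq0.
by rewrite (negPf (natrS_neq0 1)) => /eqP.
Qed.

(** The left-hand side is the arcsine mean of [X * Q' - N * Q] with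
    [Q = legendre]: the coefficients of [X * Q'] are [k] times those of [Q]. *)
Lemma legendre_sum_eq0 m : ~~ odd n -> (n < m)%N ->
  \sum_(k < m) (k%:R - N) * arcsine_moment k * legendre_coef N k = 0.
Proof.
move=> even_n lt_nm; apply: (mulfI (natrS_neq0 1)); rewrite mulr0.
rewrite -[RHS](arcsine_mean_deriv_legendre even_n) -arcsine_mean_legendre.
congr (_ * _); rewrite (@arcsine_mean_widen m); last first.
  apply: leq_trans lt_nm; rewrite -size_legendre.
  apply/leq_sizeP => k le_k; rewrite coefB coefZ coefXM.
  rewrite (leq_sizeP _ _ _ _ le_k) //.
  case: k le_k => [|k] le_k; first by rewrite mulr0 subr0.
  rewrite (coef_deriv legendre) (leq_sizeP _ _ _ _ le_k) //.
  by rewrite mul0rn mulr0 subr0.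
apply: eq_bigr => k _; rewrite coefB coefZ (coefXM legendre^`()).
have -> : (if k == 0%N :> nat then 0 else legendre^`()`_k.-1)
    = k%:R * legendre`_k.
  case: k => [[|j] lt_jm] /=; first by rewrite mul0r.
  by rewrite (coef_deriv legendre) mulr_natl.
by rewrite coef_legendre; ring.
Qed.

End Legendre.

(** * p-adic divisibility *)

(** Both sides are products over [i] of
    [(x - i) * (-1 - x - i) = i * (i + 1) - x * (x + 1)]. *)
Lemma gbinom_legendre_coef (F : fieldType) (x : F) k :
  gbinom x k * gbinom (- 1 - x) k = legendre_coef F (x * (x + 1)) k.
Proof.
rewrite /gbinom /legendre_coef mulf_div -expr2 -big_split /=; congr (_ / _).
by apply: eq_bigr => i _; ring.
Qed.

Lemma weight_factor (F : fieldType) (b k m u v : F) : b != 0 ->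
  (b ^+ 2 * k + b - 1) * m * u * v =
  b ^+ 2 * ((k - (- 1 / b) * (- 1 / b + 1)) * m * (u * v)).
Proof. by move=> b_neq0; field. Qed.

Lemma two_roots_factor (R : idomainType) (f : {poly R}) (u v x : R) :
  u != v -> f.[u] = 0 -> f.[v] = 0 ->
  exists z, f.[x] = (x - u) * (x - v) * z.
Proof.
move=> neq_uv /rootP/factor_theorem[g ->].
rewrite hornerM hornerXsubC => /eqP; rewrite mulf_eq0 subr_eq0 orbC.
rewrite eq_sym (negPf neq_uv) => /eqP/rootP/factor_theorem[h ->].
by exists h.[x]; rewrite !(hornerM, hornerXsubC); ring.
Qed.

Section PadicSum.

Variables (p : nat) (p_pr : prime p).
Local Notation Zp := (padic_int p_pr).
Local Notation Qp := (padic_num p_pr).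
Local Notation tofrac := (@FracField.tofrac (padic_int p_pr)).

Lemma padic_natr_eq0 m : (m%:R == 0 :> Zp) = (m == 0%N).
Proof.
apply/eqP/eqP => [|->//]; rewrite padic_natE => /(congr1 (fun x : Zp => x m)) /=.
rewrite mod0n modn_small // (leq_trans (ltn_expl m (prime_gt1 p_pr))) //.
by rewrite leq_exp2l // prime_gt1.
Qed.

Lemma padic_num_char0 : [pchar Qp] =i pred0.
Proof.
apply/pcharf0P => m; rewrite -(rmorph_nat tofrac) tofrac_eq0.
exact: padic_natr_eq0.
Qed.

Definition sum_coef (k : nat) : Zp := 'C(2 * k, k)%:R / 4%:R ^+ k / k`!%:R ^+ 2.

(** The sum of the theorem as a polynomial in [x * (x + 1)], up to the factor
    [b ^ 2]. *)
Definition sum_poly : {poly Zp} :=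
  \sum_(k < p) (k%:R - 'X) * (sum_coef k)%:P
    * \prod_(i < k) ((i * i.+1)%:R - 'X).

Hypothesis p_odd : odd p.

Lemma tofrac_sum_coef k : (k < p)%N ->
  tofrac (sum_coef k) = arcsine_moment Qp k / k`!%:R ^+ 2.
Proof.
move=> lt_kp; rewrite /sum_coef /arcsine_moment.
have u4 : (4%:R : Zp) \is a GRing.unit.
  apply: padic_natr_unit; rewrite (Euclid_dvdX 2 2 p_pr) andbT.
  by rewrite dvdn_prime2 //; apply: contraL p_odd => /eqP->.
have uk : (k`!%:R : Zp) \is a GRing.unit.
  apply: padic_natr_unit; elim: k lt_kp => [|k IHk] lt_kp.
    by rewrite fact0 dvdn1 neq_ltn prime_gt1 ?orbT.
  by rewrite factS Euclid_dvdM // negb_or gtnNdvd // IHk // ltnW.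
rewrite !rmorphM !rmorphV ?unitrX // !rmorphXn !rmorph_nat.
by [].
Qed.

Lemma tofrac_sum_poly x : tofrac sum_poly.[x] =
  \sum_(k < p) (k%:R - tofrac x) * arcsine_moment Qp k
    * legendre_coef Qp (tofrac x) k.
Proof.
rewrite /sum_poly horner_sum rmorph_sum; apply: eq_bigr => k _ /=.
have hE m : (m%:R - 'X).[x] = m%:R - x.
  by rewrite hornerD hornerN hornerX -polyC_natr hornerC.
rewrite !hornerM hornerC horner_prod hE 2!tofracM tofrac_sum_coef //.
rewrite rmorph_prod tofracB rmorph_nat /legendre_coef.
rewrite (eq_bigr (fun i : 'I_k => (i * i.+1)%:R - tofrac x)); last first.
  by move=> i _; rewrite hE /= tofracB rmorph_nat.
by ring.
Qed.

Lemma sum_poly_root n : ~~ odd n -> (n < p)%N -> sum_poly.[(n * n.+1)%:R] = 0.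
Proof.
move=> even_n lt_np; apply/eqP; rewrite -tofrac_eq0 tofrac_sum_poly rmorph_nat.
by rewrite legendre_sum_eq0 //; exact: padic_num_char0.
Qed.

(** The residues [a] of [x] and [a' = p - 1 - a] of [-1 - x] are both even and
    give two roots of [sum_poly] congruent to [x * (x + 1)] modulo [p].  Distinct
    roots contribute one factor [p] each, a common one contributes two. *)
Lemma sum_poly_dvd (x : Zp) : ~~ odd (padic_res x) ->
  exists z, sum_poly.[x * (x + 1)] = (p ^ 2)%:R * z.
Proof.
have [t xE] := padic_resP x; set a := padic_res x in xE * => even_a.
have lt_ap : (a < p)%N := padic_res_lt x.
have p_gt0 := prime_gt0 p_pr.
pose a' := (p.-1 - a)%N.
have lt_a'p : (a' < p)%N by rewrite (leq_ltn_trans (leq_subr _ _)) // prednK.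
have even_a' : ~~ odd a'.
  rewrite oddB; last by rewrite -ltnS prednK.
  by rewrite (negPf even_a) addbF -oddS prednK // p_odd.
have a'E : a'%:R = p%:R - 1 - a%:R :> Zp.
  rewrite natrB; last by rewrite -ltnS prednK.
  have -> : p%:R = p.-1%:R + 1 :> Zp by rewrite natr1 prednK.
  by rewrite addrK.
have r1 := sum_poly_root a even_a lt_ap.
have r2 := sum_poly_root a' even_a' lt_a'p.
(* The difference of the two roots is [p * (2 * a + 1 - p)]. *)
have [e|ne] := eqVneq ((a * a.+1)%:R : Zp) (a' * a'.+1)%:R.
  have pE : p%:R = 2 * a%:R + 1 :> Zp.
    have p_neq0 : p%:R != 0 :> Zp by rewrite padic_natr_eq0 -lt0n.
    move/eqP: e; rewrite -subr_eq0 !natrM -[a.+1%:R]natr1 -[a'.+1%:R]natr1 a'E.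
    have -> : a%:R * (a%:R + 1) - (p%:R - 1 - a%:R) * (p%:R - 1 - a%:R + 1)
        = - (p%:R * (p%:R - (2 * a%:R + 1))) :> Zp by ring.
    rewrite oppr_eq0 mulf_eq0 (negPf p_neq0) /=.
    by rewrite subr_eq0 => /eqP.
  move/rootP/factor_theorem: r1 => [g ->]; rewrite hornerM hornerXsubC.
  exists (t * (1 + t) * g.[x * (x + 1)]).
  have -> : x * (x + 1) - (a * a.+1)%:R = p%:R ^+ 2 * (t * (1 + t)).
    rewrite natrM -[a.+1%:R]natr1.
    have -> : x * (x + 1) - a%:R * (a%:R + 1) = (x - a%:R) * (x + a%:R + 1).
      by ring.
    rewrite {1}xE {1}pE xE pE; ring.
  by rewrite natrX; ring.
have [z ->] := two_roots_factor _ _ _ _ (x * (x + 1)) ne r1 r2.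
exists (t * (x + a%:R + 1) * ((1 + t) * (x - a'%:R)) * z).
rewrite natrX !natrM -[a.+1%:R]natr1 -[a'.+1%:R]natr1.
have e1 : x - a%:R = p%:R * t by rewrite xE addrC addKr.
have e2 : x + a'%:R + 1 = p%:R * (1 + t) by rewrite xE a'E; ring.
have -> : x * (x + 1) - a%:R * (a%:R + 1) = (x - a%:R) * (x + a%:R + 1) by ring.
have -> : x * (x + 1) - a'%:R * (a'%:R + 1) = (x - a'%:R) * (x + a'%:R + 1).
  by ring.
by rewrite e1 e2; ring.
Qed.

Lemma padic_p_nonunit : (p%:R : Zp) \isn't a GRing.unit.
Proof.
apply/negP => /divrr; rewrite [p%:R]padic_natE.
move/(congr1 (fun x : Zp => x 0%N)) => /=.
by rewrite expn1 modnn mul0n mod0n modn_small // prime_gt1.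
Qed.

End PadicSum.

Theorem corollary1 (b p : nat) (b_gt0 : (0 < b)%N) (p_pr : prime p)
    (p_mod_b : (p%:Z = 1 %[mod b%:Z])%Z \/ (p%:Z = - 1 %[mod b%:Z])%Z)
    (res_even : (padic_res (- 1 / b%:R : padic_int p_pr) = 0 %[mod 2])%N) :
  padic_eqmod 2
    (\sum_(0 <= k < p)
       (b%:R ^+ 2 * k%:R + b%:R - 1) * ('C(2 * k, k)%:R / 4%:R ^+ k)
       * gbinom (- 1 / b%:R) k * gbinom (1 / b%:R - 1) k : padic_num p_pr)
    0.
Proof.
have not_p_dvd_b : ~~ (p %| b)%N.
  apply/negP => p_b; have: (p%:Z %| 1)%Z.
    have p_p : (p%:Z %| p%:Z)%Z := dvdzz _.
    have p_bz : (p%:Z %| b%:Z)%Z := p_b.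
    case: p_mod_b => /eqP; rewrite eqz_mod_dvd => /(dvdz_trans p_bz).
      by rewrite rpredBl.
    by rewrite opprK rpredDl.
  rewrite dvdzE dvdn1 /= => /eqP p1.
  by move: (prime_gt1 p_pr); rewrite p1.
have ub := padic_natr_unit p_pr not_p_dvd_b.
set x : padic_int p_pr := - 1 / b%:R in res_even.
have even_res : ~~ odd (padic_res x) by rewrite -eqb0 -modn2 res_even.
have p_odd : odd p.
  (* Modulo 2 an even residue is 0, whereas -1/b is a unit. *)
  case: (even_prime p_pr) => // p2; exfalso.
  have res0 : padic_res x = 0%N.
    have: (padic_res x < 2)%N by rewrite -p2 padic_res_lt.
    by case: (padic_res x) even_res => [|[|]].
  have [t] := padic_resP x; rewrite res0 add0r => xE.
  have := padic_p_nonunit _ p_pr; apply/negP/negPn.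
  have : x \is a GRing.unit by rewrite unitrM unitrN1 unitrV.
  by rewrite xE unitrM => /andP[].
have [z sumE] := sum_poly_dvd _ _ p_odd x even_res.
exists (b%:R ^+ 2 * z); rewrite subr0 big_mkord.
have nb : (b%:R : padic_num p_pr) != 0.
  by rewrite ((pcharf0P _).1 (padic_num_char0 p p_pr)) -lt0n.
have xE : FracField.tofrac x = - 1 / b%:R.
  by rewrite tofracM tofracN tofrac1 rmorphV // rmorph_nat.
have e := tofrac_sum_poly _ p_pr p_odd (x * (x + 1)).
have NE : FracField.tofrac (x * (x + 1)) = (- 1 / b%:R) * (- 1 / b%:R + 1).
  by rewrite tofracM tofracD tofrac1 xE.
rewrite sumE NE tofracM rmorph_nat in e.
rewrite tofracM tofracXn rmorph_nat mulrCA e mulr_sumr; apply: eq_bigr => k _.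
rewrite -gbinom_legendre_coef.
have -> : - 1 - - 1 / b%:R = 1 / b%:R - 1 :> padic_num p_pr.
  by rewrite mulN1r opprK addrC div1r.
exact: weight_factor.
Qed.
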